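(* Let $G=(V_G,E_G)$ and $H=(V_H,E_H)$ be finite simple connected graphs with $|V_G|=n$, $|V_H|=m$, $V_G=\{x_1,\dots,x_n\}$. Let $u=(y_1,\ldots,y_n)x\in V_{G\wr H}$ and $p=\frac{m-1}{m}$. Then $u$ is median in $G\wr H$ if and only if $y_1,\dots,y_n$ are all median in $H$ and $x$ is $p$TS-median in $G$. In particular, $G\wr H$ is distance-balanced if and only if $G$ is $p$TS-distance-balanced and $H$ is distance-balanced.
   Context: For a graph $K$ of order $N$, $d_K(u)=\frac1N\sum_{v}d_K(u,v)$ (geodesic distance); $u$ is median if $d_K(u)=\min_v d_K(v)$. $K$ is distance-balanced if for every edge $uv$, $|\{z:d_K(z,u)<d_K(z,v)\}|=|\{z:d_K(z,v)<d_K(z,u)\}|$. For $A\subseteq V_G$, $\rho_A(u,v)$ is the length of a shortest walk in $G$ from $u$ to $v$ visiting every vertex of $A$; $p_A=p^{|A|}(1-p)^{n-|A|}$; $d_G^p(u)=\frac1n\sum_{v}\sum_{A\subseteq V_G}p_A\rho_A(u,v)$; $x$ is $p$TS-median if $d_G^p(x)=\min_v d_G^p(v)$. For edges $uv$ of $G$, $W^A_{uv}=\{z:\rho_A(z,u)<\rho_A(z,v)\}$, $w^p_{uv}=\sum_A p_A|W^A_{uv}|$; $G$ is $p$TS-distance-balanced if $w^p_{uv}=w^p_{vu}$ for every edge $uv$. The wreath product $G\wr H$ has vertex set $\{(y_1,\dots,y_n)x_i: y_j\in V_H, x_i\in V_G\}$ with $(y_1,\dots,y_n)x_i\sim(y'_1,\dots,y'_n)x_k$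 iff either ($i=k$, $y_j=y'_j$ for $j\ne i$, $y_i\sim y'_i$ in $H$) or ($y_j=y'_j$ for all $j$ and $x_i\sim x_k$ in $G$). *)

(* Defs.v *)
From HB Require Import structures.
From mathcomp Require Import all_boot all_order all_algebra.
From mathcomp Require Import boolp.

Set Implicit Arguments.
Unset Strict Implicit.
Unset Printing Implicit Defensive.

Import Order.TTheory GRing.Theory Num.Theory.
Local Open Scope ring_scope.

Record sgraph := SGraph {
  vertex :> finType;
  adj : rel vertex;
  adj_sym : symmetric adj;
  adj_irr : irreflexive adj }.
Arguments adj {s}.

(* The graph without vertices does not count as connected. *)
Definition connected_graph (K : sgraph) : Prop :=
  (0 < #|K|)%N /\ forall u v : K, connect adj u v.

(* Least k with P k; the value 0 when there is none is never reached for the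
   walk lengths below when the graph is connected. *)
Definition least (P : pred nat) : nat :=
  match pselect (exists k, P k) with
  | left exP => ex_minn exP
  | right _ => 0%N
  end.

(* A walk of length k from u is the list u :: s, with s of size k. *)
Definition has_walk (K : sgraph) (u v : K) (k : nat) : bool :=
  [exists s : k.-tuple K, path adj u s && (last u s == v)].

Definition has_walk_through (K : sgraph) (A : {set K}) (u v : K) (k : nat)
  : bool :=
  [exists s : k.-tuple K,
    [&& path adj u s, last u s == v & [forall a in A, a \in u :: s]]].

Definition dist (K : sgraph) (u v : K) : nat := least (has_walk u v).

Definition rho (G : sgraph) (A : {set G}) (u v : G) : nat :=
  least (has_walk_through A u v).

Definition mean_dist (K : sgraph) (u : K) : rat :=
  #|K|%:R^-1 * \sum_(v : K) (dist u v)%:R.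

Definition median (K : sgraph) (u : K) : Prop :=
  forall v : K, mean_dist u <= mean_dist v.

Definition distance_balanced (K : sgraph) : Prop :=
  forall u v : K, adj u v ->
    #|[set z : K | (dist z u < dist z v)%N]| =
    #|[set z : K | (dist z v < dist z u)%N]|.

Definition prob (G : sgraph) (p : rat) (A : {set G}) : rat :=
  p ^+ #|A| * (1 - p) ^+ (#|G| - #|A|).

Definition TS_mean_dist (G : sgraph) (p : rat) (u : G) : rat :=
  #|G|%:R^-1 *
  \sum_(v : G) \sum_(A : {set G}) prob p A * (rho A u v)%:R.

Definition TS_median (G : sgraph) (p : rat) (x : G) : Prop :=
  forall v : G, TS_mean_dist p x <= TS_mean_dist p v.

Definition W (G : sgraph) (A : {set G}) (u v : G) : {set G} :=
  [set z | (rho A z u < rho A z v)%N].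

Definition w (G : sgraph) (p : rat) (u v : G) : rat :=
  \sum_(A : {set G}) prob p A * #|W A u v|%:R.

Definition TS_distance_balanced (G : sgraph) (p : rat) : Prop :=
  forall u v : G, adj u v -> w p u v = w p v u.

(* The vertex (y_1, ..., y_n) x_i is the pair (y, x_i), with the tuple y
   indexed by the vertices x_1, ..., x_n of G themselves. *)
Definition wreath_adj (G H : sgraph) : rel ({ffun G -> H} * G) := fun u v =>
  [&& u.2 == v.2,
      [forall j, (j != u.2) ==> (u.1 j == v.1 j)]
    & adj (u.1 u.2) (v.1 u.2)]
  || (u.1 == v.1) && adj u.2 v.2.

Lemma wreath_adj_sym (G H : sgraph) : symmetric (@wreath_adj G H).
Proof.
have imp u v : @wreath_adj G H u v -> @wreath_adj G H v u.
  case: u v => [y x] [y' x'] /orP[/and3P[/= /eqP <- /forallP yy' e]|/=].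
    apply/orP; left; rewrite /= eqxx adj_sym e andbT /=.
    by apply/forallP => j; rewrite [y' j == _]eq_sym.
  move=> /andP[/eqP -> e]; apply/orP; right => /=.
  by rewrite eqxx adj_sym e.
by move=> u v; apply/idP/idP => /imp.
Qed.

Lemma wreath_adj_irr (G H : sgraph) : irreflexive (@wreath_adj G H).
Proof. by move=> u; rewrite /wreath_adj !adj_irr !andbF. Qed.

Definition wreath (G H : sgraph) : sgraph :=
  SGraph (@wreath_adj_sym G H) (@wreath_adj_irr G H).

(* Main.v *)
(* Read a vertex (y, x) of the wreath product as a lamplighter standing at x,
   y_j being the state of the lamp at j.  To go from (y, x) to (y', x') the
   lamplighter must visit every lamp where y and y' differ and change each y_j
   into y'_j along edges of H, so
     d((y, x), (y', x')) = rho_A(x, x') + sum_j d_H(y_j, y'_j),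
   where A is the set of lamps where y and y' differ.  For a uniformly random
   y', each lamp lies in A independently with probability p = (m - 1)/m, and
   averaging over (y', x') gives
     d(y, x) = d^p_G(x) + sum_j d_H(y_j).
   The terms of this sum vary independently, which gives the statement on
   medians.  The one on balance follows because rho_A(., z) differs by at most
   one at adjacent vertices, so that n (d^p(u) - d^p(v)) = w^p_vu - w^p_uv:
   being balanced means that the mean distance takes the same value at adjacent
   vertices.  Ordinary distances and balance are the case p = 0, where A is
   almost surely empty. *)
Require Import Defs.
From mathcomp Require Import all_boot all_order all_algebra.
From mathcomp Require Import boolp.
Import Order.TTheory GRing.Theory Num.Theory.

Set Implicit Arguments.
Unset Strict Implicit.
Unset Printing Implicit Defensive.

Local Open Scope nat_scope.

Section Least.

Variable P : pred nat.

Lemma least_sat k : P k -> P (least P).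
Proof.
rewrite /least; case: pselect => [exP _|nP Pk]; first by case: ex_minnP.
by case: nP; exists k.
Qed.

Lemma least_le k : P k -> least P <= k.
Proof.
rewrite /least; case: pselect => [exP Pk|//].
by case: ex_minnP => i _; apply.
Qed.

End Least.

Section Walks.

Variable K : sgraph.
Implicit Types (u v z : K) (A B : {set K}).

Lemma has_walk_throughP A u v k :
  reflect (exists s : seq K, [/\ size s = k, path adj u s, last u s = v
                             & {subset A <= u :: s}])
          (has_walk_through A u v k).
Proof.
apply: (iffP existsP) => [[s /and3P[us /eqP lv As]]|[s [sk us lv As]]].
  by exists s; rewrite size_tuple; split=> // a; move/forall_inP: As; apply.
exists (tcast sk (in_tuple s)); rewrite val_tcast us lv eqxx /=.
exact/forall_inP.
Qed.

Lemma has_walk_through0 u v : has_walk_through set0 u v =1 has_walk u v.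
Proof.
move=> k; apply: eq_existsb => s.
have -> : [forall a in set0, a \in u :: s].
  by apply/forall_inP => a; rewrite inE.
by rewrite andbT.
Qed.

Lemma has_walkP u v k :
  reflect (exists s : seq K, [/\ size s = k, path adj u s & last u s = v])
          (has_walk u v k).
Proof.
rewrite -has_walk_through0.
apply: (iffP (has_walk_throughP _ _ _ _)) => [] [s [sk us lv]]; exists s => //.
by split=> // a; rewrite inE.
Qed.

Lemma has_walk0 u : has_walk u u 0.
Proof. by apply/has_walkP; exists [::]. Qed.

Lemma has_walk1 u v : adj u v -> has_walk u v 1.
Proof. by move=> uv; apply/has_walkP; exists [:: v] => /=; rewrite uv. Qed.

Lemma connect_has_walk u v : connect adj u v <-> exists k, has_walk u v k.
Proof.
split=> [/connectP[s us ->]|[k /has_walkP[s [_ us <-]]]].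
  by exists (size s); apply/has_walkP; exists s.
by apply/connectP; exists s.
Qed.

Lemma has_walk_throughD A B u v z k l :
    has_walk_through A u v k -> has_walk_through B v z l ->
  has_walk_through (A :|: B) u z (k + l).
Proof.
move=> /has_walk_throughP[s [sk us sv As]] /has_walk_throughP[t [tl vt tz Bt]].
apply/has_walk_throughP; exists (s ++ t).
rewrite size_cat sk tl cat_path us sv vt last_cat sv; split=> // a.
rewrite -cat_cons mem_cat in_setU => /orP[/As -> //|/Bt].
by rewrite inE -sv => /predU1P[->|->]; rewrite ?mem_last ?orbT.
Qed.

Lemma has_walkD u v z k l :
  has_walk u v k -> has_walk v z l -> has_walk u z (k + l).
Proof.
by rewrite -!has_walk_through0 -{3}(setU0 set0); apply: has_walk_throughD.
Qed.

Lemma has_walk_through_sym A u v k :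
  has_walk_through A u v k = has_walk_through A v u k.
Proof.
suff imp x z : has_walk_through A x z k -> has_walk_through A z x k.
  by apply/idP/idP; apply: imp.
move=> /has_walk_throughP[s [sk us lv As]]; apply/has_walk_throughP.
have rev_walk : z :: rev (belast x s) = rev (x :: s).
  by rewrite [in RHS]lastI rev_rcons lv.
exists (rev (belast x s)); split; first by rewrite size_rev size_belast.
- by rewrite -lv rev_path; apply: sub_path us => a b; rewrite adj_sym.
- by rewrite -[LHS]/(last z (z :: _)) rev_walk rev_cons last_rcons.
- by move=> a Aa; rewrite rev_walk mem_rev; apply: As.
Qed.

Lemma has_walk_through_setU1 A u v :
  has_walk_through (u |: A) u v =1 has_walk_through A u v.
Proof.
move=> k; apply/has_walk_throughP/has_walk_throughP => [] [s [sk us lv As]];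
  exists s; split=> // a.
  by move=> Aa; apply: As; rewrite setU1r.
by case/setU1P => [->|/As //]; rewrite mem_head.
Qed.

Lemma has_walk_lipschitz (f : K -> nat) u v k :
    (forall a b, adj a b -> f a <= (f b).+1) ->
  has_walk u v k -> f u <= f v + k.
Proof.
move=> f_adj /has_walkP[s [<- + <-]].
elim: s u => [|a s IHs] u /=; first by rewrite addn0.
by case/andP=> /f_adj fua /IHs fas; rewrite addnS (leq_trans fua).
Qed.

Lemma dist_rho0 u v : dist u v = rho set0 u v.
Proof. by rewrite /rho (funext (has_walk_through0 u v)). Qed.

Lemma rho_sym A u v : rho A u v = rho A v u.
Proof. by rewrite /rho (funext (has_walk_through_sym A u v)). Qed.

Lemma rho_setU1 A u v : rho (u |: A) u v = rho A u v.
Proof. by rewrite /rho (funext (has_walk_through_setU1 A u v)). Qed.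

Lemma dist_xx u : dist u u = 0.
Proof. by apply/eqP; rewrite -leqn0; apply/least_le/has_walk0. Qed.

Hypothesis connK : connected_graph K.

Lemma rho_walk A u v : has_walk_through A u v (rho A u v).
Proof.
suff [k] : exists k, has_walk_through A u v k by apply: least_sat.
rewrite -[A]set_enum; elim: (enum A) u => [|a r IHr] u.
  have [k uv] := (connect_has_walk u v).1 (connK.2 u v).
  by exists k; rewrite set_nil has_walk_through0.
have [k ua] := (connect_has_walk u a).1 (connK.2 u a).
have [l av] := IHr a; exists (k + l).
rewrite set_cons -[_ |: _]set0U; apply: (has_walk_throughD (v := a)).
  by rewrite has_walk_through0.
by rewrite has_walk_through_setU1.
Qed.

Lemma dist_walk u v : has_walk u v (dist u v).
Proof. by rewrite dist_rho0 -has_walk_through0; apply: rho_walk. Qed.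

Lemma rho_adj_le A u v z : adj u v -> rho A u z <= (rho A v z).+1.
Proof.
move=> /has_walk1; rewrite -has_walk_through0 -add1n -[A in X in X <= _]set0U.
by move=> uv; apply/least_le/(has_walk_throughD uv)/rho_walk.
Qed.

Lemma dist_adj_le u v z : adj u v -> dist u z <= (dist v z).+1.
Proof. by rewrite !dist_rho0; apply: rho_adj_le. Qed.

End Walks.

Lemma has_walk_homo (K L : sgraph) (f : K -> L) u v k :
  {homo f : a b / adj a b} -> has_walk u v k -> has_walk (f u) (f v) k.
Proof.
move=> f_adj /has_walkP[s [sk us lv]]; apply/has_walkP; exists (map f s).
by rewrite size_map last_map lv (homo_path f_adj us).
Qed.

Section Update.

Variables (I : finType) (T : eqType).
Implicit Types (y : {ffun I -> T}) (b : T).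

Definition update y x b : {ffun I -> T} :=
  [ffun j => if j == x then b else y j].

Definition diff_set y y' : {set I} := [set j | y j != y' j].

Lemma update_id y x : update y x (y x) = y.
Proof. by apply/ffunP => j; rewrite ffunE; case: eqP => [->|]. Qed.

Lemma diff_set_update y y' x b :
  x |: diff_set (update y x b) y' = x |: diff_set y y'.
Proof. by apply/setP => j; rewrite !inE ffunE; case: eqVneq. Qed.

Lemma diff_set_update_target y y' x :
  diff_set (update y x (y' x)) y' = diff_set y y' :\ x.
Proof.
apply/setP => j; rewrite !inE ffunE.
by case: (eqVneq j x) => [->|]; rewrite ?eqxx.
Qed.

Lemma diff_set_eq0 y y' : (diff_set y y' == set0) = (y == y').
Proof.
apply/eqP/eqP => [/setP diff0|->]; last by apply/setP => j; rewrite !inE eqxx.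
by apply/ffunP => j; have := diff0 j; rewrite !inE => /negbFE/eqP.
Qed.

Lemma big_update (R : Type) (idx : R) (op : Monoid.com_law idx)
    (f : I -> T -> R) y x b :
  \big[op/idx]_j f j (update y x b j) =
  op (f x b) (\big[op/idx]_(j | j != x) f j (y j)).
Proof.
rewrite (bigD1 x) //= ffunE eqxx; congr (op _ _).
by apply: eq_bigr => j jx; rewrite ffunE (negPf jx).
Qed.

End Update.

Lemma card_diff_set (I T : finType) (y : {ffun I -> T}) (A : {set I}) :
  #|[pred y' | diff_set y y' == A]| = #|T|.-1 ^ #|A|.
Proof.
pose F j : {pred T} := if j \in A then predC1 (y j) else pred1 (y j).
have -> : #|[pred y' | diff_set y y' == A]| = #|family F|.
  apply: eq_card => y'; rewrite [LHS]inE; apply/eqP/familyP => [diffA j|Fy].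
    by rewrite /F -diffA inE eq_sym; case: ifP => [|/negbT/negPn]; rewrite inE.
  apply/setP => j; have := Fy j; rewrite /F inE eq_sym.
  by case: (j \in A); rewrite inE => // ->.
rewrite card_family foldrE big_map big_enum /= (bigID (mem A)) /=.
rewrite [X in _ * X]big1 ?muln1 => [|j /negPf jA]; last first.
  by rewrite /F jA card1.
by rewrite -prod_nat_const; apply: eq_bigr => j jA; rewrite /F jA cardC1.
Qed.

Section WreathDistance.

Variables G H : sgraph.
Implicit Types (x : G) (y : {ffun G -> H}) (b : H) (u v : wreath G H).

Lemma wreath_adjP y x v :
  reflect ((exists2 b, adj (y x) b & v = (update y x b, x)) \/
           (exists2 x', adj x x' & v = (y, x')))
          (adj ((y, x) : wreath G H) v).
Proof.
apply: (iffP orP) => -[].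
- case: v => y' x' /and3P[/= /eqP <- /forallP yy' yb]; left.
  exists (y' x) => //; congr (_, _); apply/ffunP => j; rewrite ffunE.
  by case: eqVneq (yy' j) => [->|_ /= /eqP].
- by case: v => y' x' /andP[/= /eqP <- xx']; right; exists x'.
- case=> b yb ->; left; rewrite /= ffunE !eqxx yb andbT.
  by apply/forallP => j; rewrite ffunE; apply/implyP => /negPf ->.
- by case=> x' xx' ->; right; rewrite /= eqxx.
Qed.

Lemma wreath_walk_update y x b k :
  has_walk (y x) b k -> has_walk ((y, x) : wreath G H) (update y x b, x) k.
Proof.
pose f a : wreath G H := (update y x a, x).
have f_adj : {homo f : a c / adj a c}.
  move=> a c ac; apply/wreath_adjP; left; exists c; first by rewrite ffunE eqxx.
  by congr (_, _); apply/ffunP => j; rewrite !ffunE; case: eqP.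
by move/(has_walk_homo f_adj); rewrite /f update_id.
Qed.

Definition lamplighter_cost u v : nat :=
  rho (diff_set u.1 v.1) u.2 v.2 + \sum_j dist (u.1 j) (v.1 j).

Lemma lamplighter_cost_xx u : lamplighter_cost u u = 0.
Proof.
have /eqP diff0 : diff_set u.1 u.1 == set0 by rewrite diff_set_eq0.
rewrite /lamplighter_cost diff0 -dist_rho0 dist_xx.
by rewrite big1 // => j _; rewrite dist_xx.
Qed.

Hypotheses (connG : connected_graph G) (connH : connected_graph H).

Lemma lamplighter_cost_adj_le u v z :
  adj u v -> lamplighter_cost u z <= (lamplighter_cost v z).+1.
Proof.
case: u => y x; rewrite /lamplighter_cost.
case/wreath_adjP=> [[b yb ->]|[x' xx' ->]] /=; last first.
  by rewrite -addSn leq_add2r rho_adj_le.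
(* The lamplighter stands at x, so whether x belongs to the set of lamps to be
   visited is irrelevant. *)
rewrite -[X in _ <= (X + _).+1]rho_setU1 diff_set_update rho_setU1 -addnS.
rewrite leq_add2l (big_update _ (fun j b => dist b (z.1 j))) (bigD1 x) //=.
by rewrite -addSn leq_add2r dist_adj_le.
Qed.

Lemma wreath_walk_set_lamp y x y' v k :
  let z := update y x (y' x) in
    has_walk ((z, x) : wreath G H) v (k + \sum_j dist (z j) (y' j)) ->
  has_walk ((y, x) : wreath G H) v (k + \sum_j dist (y j) (y' j)).
Proof.
move=> z zv; have := has_walkD (wreath_walk_update (dist_walk connH _ _)) zv.
rewrite addnCA (big_update _ (fun j b => dist b (y' j))) /= dist_xx add0n.
by rewrite [in X in _ -> X](bigD1 x).
Qed.

(* Each lamp is set to its final state the first time the walk meets it. *)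
Lemma wreath_walk_of_walk_through y x y' x' k :
    has_walk_through (diff_set y y') x x' k ->
  has_walk ((y, x) : wreath G H) (y', x') (k + \sum_j dist (y j) (y' j)).
Proof.
move=> /has_walk_throughP[s [<- + <-]]; elim: s x y => [|a s IHs] x y /=.
  move=> _ sub; apply: wreath_walk_set_lamp.
  have -> : update y x (y' x) = y'.
    apply/eqP; rewrite -diff_set_eq0 diff_set_update_target setD_eq0.
    by apply/subsetP => j /sub; rewrite !inE.
  by rewrite big1 => [|j _]; [apply: has_walk0 | rewrite dist_xx].
move=> /andP[xa pas] sub; apply: wreath_walk_set_lamp; rewrite addSn -add1n.
apply: (has_walkD (v := (update y x (y' x), a) : wreath G H)).
  by apply/has_walk1/wreath_adjP; right; exists a.
apply: IHs => // j; rewrite diff_set_update_target in_setD1 => /andP[jx /sub].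
by rewrite inE (negPf jx).
Qed.

Lemma wreath_walk_lamplighter_cost u v : has_walk u v (lamplighter_cost u v).
Proof.
by case: u v => y x [y' x']; apply/wreath_walk_of_walk_through/rho_walk.
Qed.

Lemma wreath_connected : connected_graph (wreath G H).
Proof.
split=> [|u v]; last first.
  apply/connect_has_walk; exists (lamplighter_cost u v).
  exact: wreath_walk_lamplighter_cost.
by rewrite card_prod card_ffun muln_gt0 expn_gt0 connG.1 connH.1.
Qed.

Lemma wreath_dist u v : dist u v = lamplighter_cost u v.
Proof.
apply/eqP; rewrite eqn_leq least_le ?wreath_walk_lamplighter_cost //=.
have cost_adj u1 u2 := @lamplighter_cost_adj_le u1 u2 v.
have := has_walk_lipschitz cost_adj (dist_walk wreath_connected u v).
by rewrite lamplighter_cost_xx.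
Qed.

End WreathDistance.

Local Open Scope ring_scope.

Lemma sumrB_card_lt (R : pzRingType) (T : finType) (f g : T -> nat) :
    (forall z, (f z <= (g z).+1)%N) -> (forall z, (g z <= (f z).+1)%N) ->
  \sum_z (f z)%:R - \sum_z (g z)%:R =
  #|[set z | (g z < f z)%N]|%:R - #|[set z | (f z < g z)%N]|%:R :> R.
Proof.
move=> fg gf; rewrite -!sum1dep_card !natr_sum -sumrB.
rewrite !(big_mkcond (fun z => _ < _)%N) -sumrB; apply: eq_bigr => z _ /=.
case: ssrnat.ltngtP => [lt_gf|lt_fg|->]; last by rewrite !subrr.
  have -> : f z = (g z).+1 by apply/eqP; rewrite eqn_leq fg lt_gf.
  by rewrite -natr1 addrAC subrr add0r subr0.
have -> : g z = (f z).+1 by apply/eqP; rewrite eqn_leq gf lt_fg.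
by rewrite -natr1 opprD addNKr sub0r.
Qed.

Definition edge_constant (K : sgraph) (R : Type) (f : K -> R) : Prop :=
  forall u v : K, adj u v -> f u = f v.

Section Balance.

Variable K : sgraph.
Implicit Types (u v : K) (p : rat).

Lemma sum_prob0 (F : {set K} -> rat) : \sum_A prob 0 A * F A = F set0.
Proof.
rewrite (bigD1 set0) //= big1 ?addr0 => [|A A0]; rewrite /prob.
  by rewrite cards0 expr0 subr0 expr1n !mul1r.
by rewrite expr0n cards_eq0 (negPf A0) !mul0r.
Qed.

Lemma TS_mean_dist0 u : TS_mean_dist 0 u = mean_dist u.
Proof.
by congr (_ * _); apply: eq_bigr => v _; rewrite sum_prob0 dist_rho0.
Qed.

Lemma TS_distance_balanced0 : TS_distance_balanced K 0 <-> distance_balanced K.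
Proof.
have w0 u v : w 0 u v = #|[set z : K | (dist z u < dist z v)%N]|%:R.
  rewrite /w sum_prob0; congr _%:R; apply: eq_card => z.
  by rewrite !inE !dist_rho0.
split=> bal u v /bal; rewrite !w0; last by move->.
by move/eqP; rewrite eqr_nat => /eqP.
Qed.

Hypothesis connK : connected_graph K.

Lemma TS_mean_dist_adj p u v : adj u v ->
  TS_mean_dist p u - TS_mean_dist p v = #|K|%:R^-1 * (w p v u - w p u v).
Proof.
move=> uv; rewrite -mulrBr; congr (_ * _).
rewrite exchange_big [X in _ - X]exchange_big -!sumrB.
apply: eq_bigr => A _ /=; rewrite -!mulr_sumr -!mulrBr; congr (_ * _).
under eq_bigr do rewrite rho_sym.
under [X in _ - X]eq_bigr do rewrite rho_sym.
by apply: sumrB_card_lt => z; rewrite !(rho_sym A z) rho_adj_le // adj_sym.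
Qed.

Lemma TS_distance_balancedE p :
  TS_distance_balanced K p <-> edge_constant (@TS_mean_dist K p).
Proof.
have K_neq0 : #|K|%:R^-1 != 0 :> rat.
  by rewrite invr_eq0 pnatr_eq0 -lt0n connK.1.
split=> bal u v uv; have := TS_mean_dist_adj p uv; rewrite (bal u v uv) subrr.
  by rewrite mulr0 => /subr0_eq.
by move/esym/eqP; rewrite mulf_eq0 (negPf K_neq0) subr_eq0 => /eqP.
Qed.

Lemma distance_balancedE :
  distance_balanced K <-> edge_constant (@mean_dist K).
Proof.
rewrite -TS_distance_balanced0 TS_distance_balancedE /edge_constant.
by split=> const u v /const; rewrite !TS_mean_dist0.
Qed.

End Balance.

Definition mean (R : numFieldType) (T : finType) (f : T -> R) : R :=
  #|T|%:R^-1 * \sum_t f t.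

Lemma eq_mean (R : numFieldType) (T : finType) (f g : T -> R) :
  f =1 g -> mean f = mean g.
Proof. by move=> fg; congr (_ * _); apply: eq_bigr. Qed.

Lemma meanD (R : numFieldType) (T : finType) (f g : T -> R) :
  mean (fun t => f t + g t) = mean f + mean g.
Proof. by rewrite /mean big_split mulrDr. Qed.

Lemma mean_sum (R : numFieldType) (T J : finType) (f : J -> T -> R) :
  mean (fun t => \sum_j f j t) = \sum_j mean (f j).
Proof. by rewrite /mean exchange_big mulr_sumr. Qed.

Lemma mean_const (R : numFieldType) (T : finType) (c : R) :
  (0 < #|T|)%N -> mean (fun _ : T => c) = c.
Proof.
move=> T_gt0; rewrite /mean sumr_const -[c *+ _]mulr_natl mulKf //.
by rewrite pnatr_eq0 -lt0n.
Qed.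

Lemma mean_pair (R : numFieldType) (T U : finType) (f : T * U -> R) :
  mean f = mean (fun u => mean (fun t => f (t, u))).
Proof.
rewrite /mean -mulr_sumr mulrA -invfM -natrM mulnC -card_prod.
by rewrite exchange_big pair_bigA; congr (_ * _); apply: eq_bigr => -[].
Qed.

Lemma mean_ffun_at (R : numFieldType) (I T : finType) (f : T -> R) (j : I) :
  (0 < #|T|)%N -> mean (fun y : {ffun I -> T} => f (y j)) = mean f.
Proof.
move=> T_gt0; have T_neq0 : #|T|%:R != 0 :> R by rewrite pnatr_eq0 -lt0n.
pose F i b := if i == j then f b else 1.
have -> : mean (fun y : {ffun I -> T} => f (y j)) =
          #|{ffun I -> T}|%:R^-1 * \sum_(y : {ffun I -> T}) \prod_i F i (y i).
  congr (_ * _); apply: eq_bigr => y _.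
  by rewrite /F -big_mkcond big_pred1_eq.
rewrite -bigA_distr_bigA card_ffun natrX -prodr_const -prodfV -big_split /=.
rewrite (bigD1 j) //= /F eqxx [X in _ * X]big1 ?mulr1 // => i /negPf ->.
by rewrite sumr_const mulVf.
Qed.

Definition neq_prob (T : finType) : rat := (#|T|%:R - 1) / #|T|%:R.

Lemma prob_neq_prob (G : sgraph) (T : finType) (A : {set G}) :
    (0 < #|T|)%N ->
  prob (neq_prob T) A = #|{ffun G -> T}|%:R^-1 * (#|T|.-1 ^ #|A|)%:R.
Proof.
move=> T_gt0; have T_neq0 : #|T|%:R != 0 :> rat by rewrite pnatr_eq0 -lt0n.
have -> : neq_prob T = #|T|.-1%:R / #|T|%:R by rewrite -subn1 natrB.
have compl : 1 - #|T|.-1%:R / #|T|%:R = #|T|%:R^-1 :> rat.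
  rewrite -{1}(divff T_neq0) -mulrBl -natrB ?leq_pred //.
  by rewrite -subn1 subKn // mul1r.
rewrite /prob compl exprMn -mulrA -exprD subnKC ?max_card // mulrC exprVn.
by rewrite card_ffun !natrX.
Qed.

Lemma mean_diff_set (G : sgraph) (T : finType) (y : {ffun G -> T})
    (f : {set G} -> rat) : (0 < #|T|)%N ->
  mean (fun y' => f (diff_set y y')) = \sum_A prob (neq_prob T) A * f A.
Proof.
move=> T_gt0; rewrite /mean (partition_big (diff_set y) predT) //= mulr_sumr.
apply: eq_bigr => A _; under eq_bigr => y' /eqP -> do [].
by rewrite sumr_const card_diff_set prob_neq_prob // -mulrA mulr_natl.
Qed.

Definition lamp_sum (R : nmodType) (I : finType) (X T : Type)
  (g : X -> R) (h : T -> R) (u : {ffun I -> T} * X) : R :=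
  g u.2 + \sum_j h (u.1 j).

Lemma lamp_sum_minimal (R : numDomainType) (I : finType) (X : Type)
    (T : eqType) (g : X -> R) (h : T -> R) (y : {ffun I -> T}) (x : X) :
  (forall v : {ffun I -> T} * X, lamp_sum g h (y, x) <= lamp_sum g h v) <->
  (forall j b, h (y j) <= h b) /\ (forall x', g x <= g x').
Proof.
rewrite /lamp_sum; split=> [min|[min_h min_g] [y' x'] /=]; last first.
  by rewrite lerD // ler_sum.
split=> [j b|x']; last by have := min (y, x'); rewrite /= lerD2r.
have := min (update y j b, x); rewrite /= lerD2l (big_update _ (fun=> h)) /=.
by rewrite (bigD1 j) //= lerD2r.
Qed.

Lemma edge_constant_lamp_sum (R : zmodType) (G H : sgraph)
    (g : G -> R) (h : H -> R) :
    (0 < #|G|)%N -> (0 < #|H|)%N ->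
  edge_constant (lamp_sum g h : wreath G H -> R) <->
  edge_constant g /\ edge_constant h.
Proof.
move=> /card_gt0P[x0 _] /card_gt0P[b0 _].
rewrite /lamp_sum; split=> [const|[const_g const_h] [y x] v].
  split=> [x x' xx'|a b ab].
    apply: (addIr (\sum_(j : G) h ([ffun=> b0] j))).
    apply: (const ([ffun=> b0], x) ([ffun=> b0], x')).
    by apply/wreath_adjP; right; exists x'.
  have /= := const ([ffun=> a], x0) (update [ffun=> a] x0 b, x0).
  rewrite (big_update _ (fun=> h)) (bigD1 x0) //= ffunE => /(_ _)/addrI/addIr.
  by apply; apply/wreath_adjP; left; exists b; rewrite ?ffunE.
case/wreath_adjP=> [[b yb ->]|[x' xx' ->]] /=; last first.
  by rewrite (const_g _ _ xx').
by rewrite (big_update _ (fun=> h)) (bigD1 x) //= (const_h _ _ yb).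
Qed.

Lemma wreath_mean_dist (G H : sgraph) (u : wreath G H) :
    connected_graph G -> connected_graph H ->
  mean_dist u = lamp_sum (TS_mean_dist (neq_prob H)) (@mean_dist H) u.
Proof.
case: u => y x connG connH; have H_gt0 := connH.1.
pose cost (v : {ffun G -> H} * G) : rat :=
  (rho (diff_set y v.1) x v.2)%:R + \sum_j (dist (y j) (v.1 j))%:R.
have -> : mean_dist ((y, x) : wreath G H) = mean cost.
  by apply: eq_mean => v; rewrite wreath_dist // natrD natr_sum.
rewrite mean_pair /cost /=; under eq_mean => x' do rewrite meanD mean_sum.
rewrite meanD mean_const ?connG.1 //; congr (_ + _).
  apply: eq_mean => x'.
  exact: (mean_diff_set y (fun A => (rho A x x')%:R) H_gt0).
apply: eq_bigr => j _.
exact: (mean_ffun_at (fun b => (dist (y j) b)%:R) j H_gt0).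
Qed.

Theorem theorem3p4 (G H : sgraph)
    (connG : connected_graph G) (connH : connected_graph H) :
  let m := #|H| in
  let p : rat := (m%:R - 1) / m%:R in
  (forall (y : {ffun G -> H}) (x : G),
     median ((y, x) : wreath G H) <->
     (forall j : G, median (y j)) /\ TS_median p x) /\
  (distance_balanced (wreath G H) <->
   TS_distance_balanced G p /\ distance_balanced H).
Proof.
move=> m p; have meanE u := wreath_mean_dist u connG connH.
split=> [y x|].
  rewrite -(lamp_sum_minimal (TS_mean_dist p) (@mean_dist H)).
  by split=> min v; have := min v; rewrite !meanE.
rewrite (distance_balancedE (wreath_connected connG connH)).
rewrite (distance_balancedE connH) (TS_distance_balancedE connG).
by rewrite (funext meanE) edge_constant_lamp_sum ?connG.1 ?connH.1.
Qed.
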